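(* Let $\mu$ be a probability measure on $\mathbb{R}^n$ satisfying the logarithmic Sobolev inequality $$\operatorname{Ent}_\mu(f^2) \leq 2 C_{\mathrm{LSI}}(\mu)\int |\nabla f|^2\, d\mu, \qquad C_{\mathrm{LSI}}(\mu)\leq 1,$$ and let $u : \mathbb{R}^n \to \mathbb{R}$ satisfy $$\operatorname{Ent}_\mu(u^2) \geq 2(1-\epsilon) \int |\nabla u|^2\, d\mu$$ for some $\epsilon \geq 0$. For any smooth function $h$ we have $$\int \nabla h \cdot \nabla u\, d\mu - \frac{1}{2} \int h u \log(u^2/\alpha)\, d\mu \leq \sqrt{\epsilon} \left( \int |\nabla u|^2\, d\mu \right)^{1/2} \left( \int |\nabla h|^2\, d\mu - \frac{1}{2} \int h^2 \log(u^2/\alpha)\, d\mu \right)^{1/2},$$ where $\alpha := \int u^2\, d\mu$.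
   Context: Here $\operatorname{Ent}_\mu(f^2) = \int f^2 \log f^2\, d\mu - \left( \int f^2\, d\mu \right) \log \int f^2\, d\mu$, and $C_{\mathrm{LSI}}(\mu)$ denotes the sharpest possible constant for $\mu$ in the logarithmic Sobolev inequality. The quantity $\int |\nabla h|^2\, d\mu - \frac12 \int h^2 \log(u^2/\alpha)\, d\mu$ is nonnegative, as a consequence of the logarithmic Sobolev inequality for $\mu$. No convexity assumption is made on $\mu$. *)

(* Defs.v *)
From HB Require Import structures.
From mathcomp Require Import all_boot all_order all_algebra.
From mathcomp Require Import all_classical all_reals all_analysis.
From mathcomp Require Import measurable_realfun.

Set Implicit Arguments.
Unset Strict Implicit.
Unset Printing Implicit Defensive.

Import Order.TTheory GRing.Theory Num.Theory.
Import numFieldNormedType.Exports.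

Local Open Scope classical_set_scope.
Local Open Scope ring_scope.

(* The library puts no measurable structure on row vectors; this alias of
   'rV[R]_n carries its Borel sigma-algebra. *)
Notation borel_rV R n := (g_sigma_algebraType (@open 'rV[R]_n)).

Section gradient.
Context {R : realType} {n : nat}.
Implicit Types (f : 'rV[R]_n -> R) (v w : 'rV[R]_n).

Definition partial (i : 'I_n) f : 'rV[R]_n -> R :=
  fun x => 'D_(delta_mx 0 i) f x.

Definition grad f : 'rV[R]_n -> 'rV[R]_n := fun x => \row_i partial i f x.

Definition dot v w : R := \sum_i v 0 i * w 0 i.

(* The library's norm on 'rV[R]_n is the sup norm, hence this definition. *)
Definition sqnorm v : R := dot v v.

Fixpoint Ck (k : nat) f : Prop :=
  if k is k'.+1 then
    (forall x, differentiable f x) /\ (forall i, Ck k' (partial i f))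
  else continuous f.

Definition smooth f : Prop := forall k, Ck k f.

End gradient.

Section log_sobolev.
Context {R : realType} {n : nat}.
Variable mu : probability (borel_rV R n) R.
Implicit Types (f g u : 'rV[R]_n -> R) (gu : 'rV[R]_n -> 'rV[R]_n).
Local Open Scope ereal_scope.

Definition sq_mass f : \bar R := \int[mu]_x ((f x) ^+ 2)%:E.

Definition energy gu : \bar R := \int[mu]_x (sqnorm (gu x))%:E.

(* Meaningful when g >= 0 has finite integral: t ln t >= - 1/e, so the value is
   then in ]-oo, +oo]. Since ln 0 = 0, the convention 0 ln 0 = 0 is built in. *)
Definition Ent g : \bar R :=
  let m := fine (\int[mu]_x (g x)%:E) in
  \int[mu]_x (g x * ln (g x))%:E - (m * ln m)%:E.

Definition LSI (C : R) : Prop :=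
  (0 <= C)%R /\
  forall f, smooth f -> sq_mass f < +oo ->
    Ent (fun x => (f x) ^+ 2)%R <= (2 * C)%:E * energy (grad f).

(* Equal to +oo when mu satisfies no logarithmic Sobolev inequality. *)
Definition C_LSI : \bar R := ereal_inf [set C%:E | C in [set C | LSI C]].

(* gu is a gradient of u in the Sobolev space H^1(mu), the closure of the smooth
   functions: (u, gu) is a limit of pairs (f, grad f), f smooth, in
   L^2(mu) x L^2(mu; R^n). *)
Definition H1_grad u gu : Prop :=
  [/\ measurable_fun setT (u : borel_rV R n -> R),
      (forall i, measurable_fun setT (fun x : borel_rV R n => gu x 0%R i)),
      sq_mass u < +oo,
      energy gu < +oo
    & exists2 f_ : nat -> 'rV[R]_n -> R, (forall k, smooth (f_ k)) &
        sq_mass (fun x => f_ k x - u x)%R @[k --> \oo] --> 0 /\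
        energy (fun x => grad (f_ k) x - gu x)%R @[k --> \oo] --> 0].

(* The logarithm is extended-real valued with log 0 = -oo; multiplied by a zero
   weight it gives 0. *)
Definition logratio (u : 'rV[R]_n -> R) (a : R) : 'rV[R]_n -> \bar R :=
  fun x => lne ((u x) ^+ 2 / a)%:E.

End log_sobolev.

Section smooth_H1.
Context {R : realType} {n : nat}.
Implicit Types f : 'rV[R]_n -> R.

Lemma continuous_borel_rV f :
  continuous f -> measurable_fun setT (f : borel_rV R n -> R).
Proof.
move=> cf; apply: (measurability _ (RGenOInfty.measurableE R)) => //.
move=> _ [_ [a ->] <-]; rewrite setTI.
by apply: sub_sigma_algebra; apply: open_comp => // x _; exact: cf.
Qed.

Lemma smooth_H1_grad (mu : probability (borel_rV R n) R) f :
  smooth f -> (sq_mass mu f < +oo)%E -> (energy mu (grad f) < +oo)%E ->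
  H1_grad mu f (grad f).
Proof.
move=> sf f2 e2; split => //.
- exact: (continuous_borel_rV (sf 0)).
- move=> i; have [_ /(_ i) ci] := sf 1.
  have := continuous_borel_rV ci; congr (measurable_fun _ _).
  by apply/funext => x; rewrite mxE.
- exists (fun=> f) => //; split; apply: cvg_near_cst; apply: nearW => k.
  + by apply: integral0_eq => x _; rewrite subrr expr0n.
  + apply: integral0_eq => x _; rewrite subrr /sqnorm /dot big1// => i _.
    by rewrite mxE mul0r.
Qed.

End smooth_H1.

(* Main.v *)
Require Import Defs.
From HB Require Import structures.
From mathcomp Require Import all_boot all_order all_algebra.
From mathcomp Require Import all_classical all_reals all_analysis.
From mathcomp Require Import measurable_realfun ring lra.

(** The duality [Ent f^2 = sup { \int f^2 phi | \int e^phi <= 1 }] turns the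
    logarithmic Sobolev inequality into the nonnegativity of the quadratic form
    [Q f = \int |grad f|^2 - 1/2 \int f^2 ln (u^2 / alpha)], for which
    [Q u = \int |grad u|^2 - 1/2 Ent u^2 <= eps \int |grad u|^2]; the claim is the
    Cauchy-Schwarz inequality for [Q].  As [Q h] may be infinite, the argument is
    run with the weight [ln ((u^2 + r^2) / (alpha + r^2))], bounded below, and
    [r] tends to [0]: the error is [O(r^2)] in [Q u], [O(r)] in the cross term,
    and nonpositive up to [O(r^2)] in [Q h].  Finite energy of [h] already forces
    [h] in L^2, by the dual inequality applied to truncations of [h]. *)

Set Implicit Arguments.
Unset Strict Implicit.

Import Order.TTheory GRing.Theory Num.Theory.
Import numFieldNormedType.Exports.

Local Open Scope classical_set_scope.
Local Open Scope ring_scope.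

(** * Real inequalities *)

Section real_inequalities.
Context {R : realType}.
Implicit Types a b c d g r t x y : R.

(** Test functions in the duality are first kept bounded because [u] and its gradient are only
    limits in L^2: for a fixed bounded [phi] the left-hand side passes to the limit, whereas the
    entropy is in general not continuous there. The regularized weight is the logarithm of a
    probability density, so it is one admissible test function for all functions at once; at [r = 0]
    it is the optimal one for [u^2], which turns the form at [u] into the deficit of [u]. Rates in
    [r] matter, and not mere limits, because for infinite [Q h] the product of the two forms can be
    of type [0 * oo]. The case [alpha = 0] stands apart: there is no density, and [gu] may be
    nonzero although [u] vanishes almost everywhere, for instance when [mu] is a Dirac mass. *)

Lemma small_parameter a c K :
  (forall t, 0 < t < 1 -> a <= c + K * t) -> a <= c.
Proof.
move=> H; apply/ler_addgt0Pr => e e0.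
pose t := Num.min 2^-1 (e / (`|K| + 1)).
have K0 : 0 < `|K| + 1 by rewrite ltr_wpDl.
have t0 : 0 < t by rewrite lt_min invr_gt0 ltr0n divr_gt0.
have t1 : t < 1 by rewrite gt_min invf_lt1 ?ltr1n.
have te : t * (`|K| + 1) <= e by rewrite -ler_pdivlMr// ge_min lexx orbT.
apply: (le_trans (H t _)); first by rewrite t0.
rewrite lerD2l; apply: le_trans te; rewrite mulrC ler_pM2l//.
by apply: le_trans (ler_norm _) _; rewrite lerDl.
Qed.

(** The Fenchel-Young inequality between [exp] and its conjugate [g ln g - g]: it is
    [1 + z <= exp z] at [z = y - ln g], multiplied by [g]. *)
Lemma mul_le_entropy g y : 0 <= g -> g * y <= g * ln g - g + expR y.
Proof.
rewrite le_eqVlt => /predU1P[<-|g0]; first by rewrite !mul0r subrr add0r expR_ge0.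
have := expR_ge1Dx (y - ln g); rewrite expRB lnK ?posrE// ler_pdivlMr//; nra.
Qed.

Lemma discriminant_le a b c : 0 <= c ->
  (forall s, 0 <= a + 2 * s * b + s ^+ 2 * c) -> b ^+ 2 <= a * c.
Proof.
rewrite le_eqVlt => /predU1P[<-|c0] H.
  rewrite mulr0; have [->|b0] := eqVneq b 0; first by rewrite expr0n.
  (* With [c = 0] the quadratic is affine in [s]; here it takes the value [-1]. *)
  have := H (- (a + 1) / (2 * b)).
  rewrite mulr0 addr0 (_ : 2 * _ * b = - (a + 1)); last by field.
  by move=> ?; lra.
have := H (- b / c); rewrite -(pmulr_rge0 _ c0).
rewrite (_ : c * _ = a * c - b ^+ 2) ?subr_ge0//.
by field; rewrite gt_eqF.
Qed.

(** From [b^2 = b'^2 + 2 b (b - b') - (b - b')^2] the error is at most [2 |b| K r]; its factor is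
    the fixed [b], hence uniform in [r]. *)
Lemma square_le_limit b Z K N :
  (forall r, 0 < r < 1 -> exists2 b', `|b - b'| <= K * r & b' ^+ 2 <= Z + N * r) ->
  b ^+ 2 <= Z.
Proof.
move=> H; apply: (@small_parameter _ _ (N + 2 * `|b| * K)) => r r01.
have [b' bb' Hb'] := H r r01.
have : `|b * (b - b')| <= `|b| * (K * r) by rewrite normrM ler_wpM2l.
rewrite ler_norml => /andP[_ bK]; have sq := sqr_ge0 (b - b').
by move: Hb' bK sq; clear; nra.
Qed.

Lemma ln_add_le a d : 0 < a -> 0 < d -> ln (a + d) <= ln a + d / a.
Proof.
move=> a0 d0; have -> : a + d = a * (1 + d / a) by field; rewrite gt_eqF.
have da : 0 < d / a by exact: divr_gt0.
rewrite lnM ?posrE//; last lra.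
by rewrite lerD2l le_ln1Dx//; lra.
Qed.

(* [ln (1 + r^2 / y^2) <= 2 ln (1 + r / |y|) <= 2 r / |y|] *)
Lemma normM_ln_add_sqr r y : 0 < r ->
  `|y| * `|ln (y ^+ 2 + r ^+ 2) - ln (y ^+ 2)| <= 2 * r.
Proof.
move=> r0; have [->|y0] := eqVneq y 0; first by rewrite normr0 mul0r mulr_ge0// ltW.
have n0 : 0 < `|y| by rewrite normr_gt0.
have y2 : 0 < y ^+ 2 by rewrite exprn_even_gt0.
have r2 : 0 < r ^+ 2 by rewrite exprn_gt0.
have : ln (y ^+ 2 + r ^+ 2) <= 2 * (ln `|y| + r / `|y|).
  apply: (@le_trans _ _ (ln ((`|y| + r) ^+ 2))).
    rewrite ler_ln ?posrE ?(addr_gt0 y2 r2) ?(exprn_gt0 _ (addr_gt0 n0 r0))//.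
    rewrite -(real_normK (num_real y)); nra.
  rewrite lnXn ?addr_gt0// mulr2n mulrDl !mul1r.
  by have := ln_add_le n0 r0; lra.
have -> : ln (y ^+ 2) = 2 * ln `|y|.
  by rewrite -(real_normK (num_real y)) lnXn// mulr2n mulrDl !mul1r.
have mono : 2 * ln `|y| <= ln (y ^+ 2 + r ^+ 2).
  rewrite (_ : 2 * _ = ln (y ^+ 2)); first
    by rewrite ler_ln ?posrE ?addr_gt0// lerDl ltW.
  by rewrite -(real_normK (num_real y)) lnXn// mulr2n mulrDl !mul1r.
move=> up; rewrite [X in _ * X]ger0_norm ?subr_ge0// mulrC -ler_pdivlMr//; lra.
Qed.

Lemma le_sqrt_prod b c x y : 0 <= x -> 0 <= y ->
  0 <= c -> b ^+ 2 <= c * x * y ->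
  b <= Num.sqrt c * Num.sqrt x * Num.sqrt y.
Proof.
move=> x0 y0 c0 bxy; rewrite -!sqrtrM ?mulr_ge0//.
by apply: le_trans (ler_norm b) _; rewrite -sqrtr_sqr ler_wsqrtr.
Qed.

End real_inequalities.

(** * Integrals and entropy *)

Section integral_lemmas.
Context d (T : measurableType d) (R : realType) (P : probability T R).
Implicit Types f g phi : T -> R.
Local Notation L1 f := (P.-integrable setT (EFin \o f)).

Lemma L1_measurable f : L1 f -> measurable_fun setT f.
Proof. by move=> /measurable_int /measurable_EFinP. Qed.

Lemma L1D f g : L1 f -> L1 g -> L1 (fun x => f x + g x).
Proof. by move=> If Ig; have := integrableD measurableT If Ig. Qed.

Lemma L1Z k f : L1 f -> L1 (fun x => k * f x).
Proof. by move=> If; have := integrableZl measurableT k If. Qed.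

Lemma L1B f g : L1 f -> L1 g -> L1 (fun x => f x - g x).
Proof. by move=> If Ig; have := integrableB measurableT If Ig. Qed.

Lemma L1_cst k : L1 (fun=> k).
Proof. exact: finite_measure_integrable_cst. Qed.

Lemma L1_norm f : L1 f -> L1 (fun x => `|f x|).
Proof. by move=> /integrable_norm. Qed.

Lemma L1_le f g : measurable_fun setT f -> L1 g ->
  (forall x, `|f x| <= g x) -> L1 f.
Proof.
move=> mf Ig fg; apply: le_integrable Ig => //; first exact/measurable_EFinP.
by move=> x _ /=; rewrite lee_fin; exact: le_trans (fg x) (ler_norm _).
Qed.

Lemma L1_bounded f B : measurable_fun setT f -> (forall x, `|f x| <= B) -> L1 f.
Proof. by move=> mf; apply: L1_le => //; exact: L1_cst. Qed.

Lemma L1_Mbounded f g B : L1 f -> measurable_fun setT g ->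
  (forall x, `|g x| <= B) -> L1 (fun x => f x * g x).
Proof.
move=> If mg gB; apply: (@L1_le _ (fun x => B * `|f x|)).
- by apply: measurable_funM => //; exact: L1_measurable.
- exact/L1Z/L1_norm.
- by move=> x; rewrite normrM mulrC ler_wpM2r.
Qed.

Lemma L1_prod f g : measurable_fun setT f -> measurable_fun setT g ->
  L1 (fun x => f x ^+ 2) -> L1 (fun x => g x ^+ 2) -> L1 (fun x => f x * g x).
Proof.
move=> mf mg If Ig; apply: (L1_le _ (L1D If Ig)).
  exact: measurable_funM.
move=> x; rewrite normrM -(real_normK (num_real (f x))).
by rewrite -(real_normK (num_real (g x))); nra.
Qed.

Lemma L1_of_sqr f : measurable_fun setT f -> L1 (fun x => f x ^+ 2) -> L1 f.
Proof.
move=> mf If; have := L1_prod mf (@measurable_cst _ _ T R setT 1) If.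
rewrite (_ : (fun x => f x * 1) = f); last by apply/funext => x; rewrite mulr1.
by apply; under eq_fun do rewrite expr1n; exact: L1_cst.
Qed.

Lemma L1_ge0 f : measurable_fun setT f -> (forall x, 0 <= f x) ->
  (\int[P]_x (f x)%:E < +oo)%E -> L1 f.
Proof.
move=> mf f0 fy; apply/integrableP; split; first exact/measurable_EFinP.
by under eq_integral do rewrite /= ger0_norm//.
Qed.

Lemma integral_L1 f : L1 f -> (\int[P]_x (f x)%:E)%E = (\int[P]_x f x)%:E.
Proof. by move=> If; rewrite /Rintegral fineK//; exact: integrable_fin_num. Qed.

Lemma Rint_D f g : L1 f -> L1 g ->
  \int[P]_x (f x + g x) = \int[P]_x f x + \int[P]_x g x.
Proof. exact: RintegralD. Qed.

Lemma Rint_B f g : L1 f -> L1 g ->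
  \int[P]_x (f x - g x) = \int[P]_x f x - \int[P]_x g x.
Proof. exact: RintegralB. Qed.

Lemma Rint_Z k f : L1 f -> \int[P]_x (k * f x) = k * \int[P]_x f x.
Proof. exact: RintegralZl. Qed.

Lemma Rint_cst k : \int[P]_x k = k.
Proof. rewrite Rintegral_cst// -[RHS]mulr1; congr (_ * _).
exact: (congr1 fine (@probability_setT _ _ _ P)). Qed.

Lemma Rint_le f g : L1 f -> L1 g -> (forall x, f x <= g x) ->
  \int[P]_x f x <= \int[P]_x g x.
Proof. by move=> If Ig fg; exact: le_Rintegral. Qed.

(** Comparing positive and negative parts separately covers integrands that are not integrable: the
    entropy may be [+oo], and the logarithmic integral at [h] may be [-oo]. *)
Lemma le_integral_measurable (F G : T -> \bar R) :
  measurable_fun setT F -> measurable_fun setT G ->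
  (forall x, F x <= G x)%E -> (\int[P]_x F x <= \int[P]_x G x)%E.
Proof.
move=> mF mG FG; rewrite integralE [leRHS]integralE; apply: leeB.
- apply: ge0_le_integral => //; [exact: measurable_funepos..|].
  by move=> x xT; apply: (@funepos_le _ _ setT); rewrite ?inE// => y _; exact: FG.
- apply: ge0_le_integral => //; [exact: measurable_funeneg..|].
  by move=> x xT; apply: (@funeneg_le _ _ setT); rewrite ?inE// => y _; exact: FG.
Qed.

(** Fatou's lemma, packaged so that a bound on the approximants also yields integrability of the
    limit; both truncation arguments below end with it. *)
Lemma fatou_bound (f_ : nat -> T -> R) f C :
  (forall k, measurable_fun setT (f_ k)) -> (forall k x, 0 <= f_ k x) ->
  measurable_fun setT f -> (forall x, f_ k x @[k --> \oo] --> f x) ->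
  (forall k, (\int[P]_x (f_ k x)%:E <= C%:E)%E) ->
  L1 f /\ \int[P]_x f x <= C.
Proof.
move=> mf_ f_0 mf cf fC.
have f0 x : 0 <= f x by apply: (cvgr_to_ge (cf x)); exact: nearW.
have fle : (\int[P]_x (f x)%:E <= C%:E)%E.
  have mEf_ k : measurable_fun setT (EFin \o f_ k) by exact/measurable_EFinP.
  have /= Fa := fatou P measurableT mEf_ (fun k x _ => f_0 k x).
  rewrite (eq_integral (fun x => limn_einf (fun k => (f_ k x)%:E))); last first.
    move=> x _; apply/esym.
    have cfx : (f_ k x)%:E @[k --> \oo] --> (f x)%:E
      by apply/fine_cvgP; split; [exact: nearW|exact: cf].
    by rewrite limn_einf_lim; apply/cvg_lim => //; exact: cvg_einfs.
  apply: (le_trans Fa); rewrite limn_einf_lim.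
  apply: lime_le; first exact: is_cvg_einfs.
  apply: nearW => k; apply: le_trans (fC k); apply: ereal_inf_lbound.
  by exists k => /=.
have If : L1 f by apply: L1_ge0 => //; exact: le_lt_trans fle (ltry _).
by split => //; rewrite -lee_fin -integral_L1.
Qed.

(* Young's inequality at [phi + ln a], with [a] the mass of [g]; when [g] has no
   mass, [a] tends to [0]. *)
Lemma entropy_dual g phi B :
  (forall x, 0 <= g x) -> L1 g -> measurable_fun setT phi ->
  (forall x, `|phi x| <= B) -> \int[P]_x expR (phi x) <= 1 ->
  ((\int[P]_x (g x * phi x))%:E <=
    \int[P]_x (g x * ln (g x))%:E - ((\int[P]_x g x) * ln (\int[P]_x g x))%:E)%E.
Proof.
move=> g0 Ig mphi phiB ephi; set m := \int[P]_x g x.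
have mg := L1_measurable Ig.
have m0 : 0 <= m by apply: Rintegral_ge0.
have Ie : L1 (fun x => expR (phi x)).
  apply: (@L1_bounded _ (expR B)); first exact: measurableT_comp.
  move=> x; rewrite ger0_norm ?expR_ge0// ler_expR.
  by have := phiB x; rewrite ler_norml => /andP[].
have Igp : L1 (fun x => g x * phi x) by exact: L1_Mbounded phiB.
have mgl : measurable_fun setT (fun x => g x * ln (g x)).
  by apply: measurable_funM => //; exact: measurableT_comp.
have key a : 0 < a ->
    ((\int[P]_x (g x * phi x) + m * ln a + m - a)%:E <=
      \int[P]_x (g x * ln (g x))%:E)%E.
  move=> a0.
  have IF : L1 (fun x => g x * phi x + (1 + ln a) * g x - a * expR (phi x)).
    by apply: L1B; [apply: L1D => //; exact: L1Z|exact: L1Z].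
  apply: (@le_trans _ _ (\int[P]_x (g x * phi x + (1 + ln a) * g x
      - a * expR (phi x)))%:E).
    rewrite Rint_B ?Rint_D ?Rint_Z//; [|exact: L1Z|apply: L1D => //|exact: L1Z].
      rewrite lee_fin -/m.
      have : a * \int[P]_x expR (phi x) <= a by rewrite ger_pMr.
      lra.
    exact: L1Z.
  rewrite -integral_L1//; apply: le_integral_measurable.
  - exact: measurable_int IF.
  - exact/measurable_EFinP.
  - move=> x; rewrite lee_fin.
    have := mul_le_entropy (phi x + ln a) (g0 x).
    by rewrite expRD (lnK a0); nra.
move: m0; rewrite le_eqVlt => /predU1P[m0|m0].
  rewrite -m0 mul0r sube0; apply/lee_addgt0Pr => e e0.
  have := key e e0; rewrite -m0 mul0r !addr0 EFinB leeBlDr//.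
by have := key m m0; rewrite addrK EFinD -leeBrDr.
Qed.

End integral_lemmas.

(** * Smooth functions *)

Section smooth_functions.
Context {R : realType} {n : nat}.
Implicit Types f g : 'rV[R]_n -> R.

Lemma partial_cst i (c : R) : partial i (fun _ : 'rV[R]_n => c) = fun=> 0.
Proof. by apply/funext => x; exact: derive_cst. Qed.

Lemma partialD i f g x : differentiable f x -> differentiable g x ->
  partial i (fun y => f y + g y) x = partial i f x + partial i g x.
Proof. by move=> df dg; apply: deriveD; exact: diff_derivable. Qed.

Lemma partialM i f g x : differentiable f x -> differentiable g x ->
  partial i (fun y => f y * g y) x = f x * partial i g x + g x * partial i f x.
Proof. by move=> df dg; apply: deriveM; exact: diff_derivable. Qed.

Lemma partialV i f x : differentiable f x -> f x != 0 ->
  partial i (fun y => (f y)^-1) x = - ((f x)^-1 * (f x)^-1 * partial i f x).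
Proof.
move=> df f0; rewrite /partial deriveV//; last exact: diff_derivable.
by rewrite -exprVn scaleNr expr2.
Qed.

Lemma Ck_continuous k f : Ck k f -> continuous f.
Proof.
by case: k => // k [df _] x; exact: differentiable_continuous.
Qed.

Lemma CkW k f : Ck k.+1 f -> Ck k f.
Proof.
elim: k f => [|k IH] f; first exact: Ck_continuous.
by move=> [df pf]; split=> // i; exact: IH.
Qed.

Lemma Ck_cst k (c : R) : Ck k (fun _ : 'rV[R]_n => c).
Proof.
elim: k c => [|k IH] c /=; first exact: cst_continuous.
by split=> [x|i]; [exact: differentiable_cst|rewrite partial_cst].
Qed.

Lemma CkD k f g : Ck k f -> Ck k g -> Ck k (fun x => f x + g x).
Proof.
elim: k f g => [|k IH] f g; first
  by move=> cf cg x; apply: continuousD; [exact: cf|exact: cg].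
move=> [df pf] [dg pg]; split=> [x|i]; first exact: differentiableD.
rewrite (_ : partial _ _ = fun x => partial i f x + partial i g x).
  exact: IH (pf i) (pg i).
by apply/funext => x; rewrite partialD.
Qed.

Lemma CkM k f g : Ck k f -> Ck k g -> Ck k (fun x => f x * g x).
Proof.
elim: k f g => [|k IH] f g; first
  by move=> cf cg x; apply: continuousM; [exact: cf|exact: cg].
move=> Cf Cg; have [[df pf] [dg pg]] := (Cf, Cg).
split=> [x|i]; first exact: differentiableM.
rewrite (_ : partial _ _ = fun x => f x * partial i g x + g x * partial i f x).
  by apply: CkD; apply: IH; [exact: CkW|exact: pg|exact: CkW|exact: pf].
by apply/funext => x; rewrite partialM.
Qed.

Lemma CkV k f : (forall x, f x != 0) -> Ck k f -> Ck k (fun x => (f x)^-1).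
Proof.
move=> f0; elim: k => [|k IH]; first
  by move=> cf x; apply: continuousV => //; exact: cf.
move=> Cf; have [df pf] := Cf.
split=> [x|i]; first exact: differentiableV.
rewrite (_ : partial _ _ =
    fun x => (-1) * ((f x)^-1 * (f x)^-1 * partial i f x)).
  apply: CkM; first exact: Ck_cst.
  by apply: CkM; [apply: CkM; apply: IH; exact: CkW|exact: pf].
by apply/funext => x; rewrite partialV// mulN1r.
Qed.

Lemma smooth_differentiable f x : smooth f -> differentiable f x.
Proof. by move=> /(_ 1)[]. Qed.

Lemma smooth_measurable f : smooth f -> measurable_fun setT (f : borel_rV R n -> R).
Proof. by move=> /(_ 0); exact: continuous_borel_rV. Qed.

Lemma smooth_grad_measurable f i : smooth f ->
  measurable_fun setT (fun x : borel_rV R n => grad f x 0 i).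
Proof.
move=> /(_ 1)[_ /(_ i)] /continuous_borel_rV.
by congr (measurable_fun _ _); apply/funext => x; rewrite mxE.
Qed.

Lemma smoothDZ f g (s : R) : smooth f -> smooth g ->
  smooth (fun x => f x + s * g x).
Proof. by move=> sf sg k; apply: CkD => //; apply: CkM => //; exact: Ck_cst. Qed.

Lemma gradDZ f g (s : R) x : smooth f -> smooth g ->
  grad (fun x => f x + s * g x) x = grad f x + s *: grad g x.
Proof.
move=> sf sg; apply/rowP => i; rewrite !mxE.
rewrite partialD; [|exact: smooth_differentiable|]; last first.
  by apply: differentiableM; [exact: differentiable_cst|exact: smooth_differentiable].
rewrite partialM ?partial_cst ?mulr0 ?addr0//; exact: smooth_differentiable.
Qed.

(* A rational truncation: bounded, and with derivative [(1 - e f^2) / (1 + e f^2)^2]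
   in [[-1, 1]]. *)
Definition ratio_trunc (e : R) f := fun x => f x * (1 + e * (f x * f x))^-1.

Lemma ratio_trunc_den_gt0 (e y : R) : 0 <= e -> 0 < 1 + e * (y * y).
Proof. by move=> e0; have := sqr_ge0 y; nra. Qed.

Lemma ratio_trunc_smooth e f : 0 <= e -> smooth f -> smooth (ratio_trunc e f).
Proof.
move=> e0 sf k; apply: CkM => //; apply: CkV.
  by move=> x; rewrite gt_eqF// ratio_trunc_den_gt0.
by apply: CkD; [exact: Ck_cst|apply: CkM; [exact: Ck_cst|exact: CkM]].
Qed.

Lemma grad_ratio_trunc e f x : 0 <= e -> smooth f ->
  grad (ratio_trunc e f) x =
  ((1 - e * (f x * f x)) / (1 + e * (f x * f x)) ^+ 2) *: grad f x.
Proof.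
move=> e0 sf; have den := ratio_trunc_den_gt0 (f x) e0.
have df := smooth_differentiable x sf.
have dc (c : R) : differentiable ((fun=> c) : 'rV[R]_n -> R) x.
  exact: differentiable_cst.
have dff : differentiable (fun y => f y * f y) x by exact: differentiableM.
have deff : differentiable (fun y => e * (f y * f y)) x by exact: differentiableM.
have dD : differentiable (fun y => 1 + e * (f y * f y)) x by exact: differentiableD.
apply/rowP => i; rewrite !mxE /ratio_trunc partialM//; last first.
  by apply: differentiableV => //; rewrite gt_eqF.
rewrite partialV ?gt_eqF// partialD// partialM// partialM// !partial_cst.
by field; rewrite gt_eqF.
Qed.

End smooth_functions.

(** * The dual logarithmic Sobolev inequality *)

Section euclidean.
Context {R : realType} {n : nat}.
Implicit Types v w : 'rV[R]_n.

Lemma sqnorm_ge0 v : 0 <= sqnorm v.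
Proof. by apply: sumr_ge0 => i _; rewrite -expr2 sqr_ge0. Qed.

Lemma sqnormZ c v : sqnorm (c *: v) = c ^+ 2 * sqnorm v.
Proof.
by rewrite /sqnorm /dot mulr_sumr; apply: eq_bigr => i _; rewrite !mxE; ring.
Qed.

Lemma sqnormDZ v w s :
  sqnorm (v + s *: w) = sqnorm v + 2 * s * dot w v + s ^+ 2 * sqnorm w.
Proof.
rewrite /sqnorm /dot !mulr_sumr -!big_split/=; apply: eq_bigr => i _.
by rewrite !mxE; ring.
Qed.

Lemma dot_le v w : `|dot v w| <= sqnorm v + sqnorm w.
Proof.
have := sqnorm_ge0 (w + 1 *: v); have := sqnorm_ge0 (w + (-1) *: v).
rewrite !sqnormDZ ler_norml; have := sqnorm_ge0 v; have := sqnorm_ge0 w; nra.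
Qed.

(** Expanding [v = w + (v - w)], the gap is [t^-1] times the sum of the squares
    [(t w_i - (v_i - w_i))^2]. The coefficient of [sqnorm w] tends to 1 with [t], so constants stay
    sharp in the limit. *)
Lemma sqnorm_le_perturb t v w : 0 < t ->
  sqnorm v <= (1 + t) * sqnorm w + (1 + t^-1) * sqnorm (v - w).
Proof.
move=> t0; rewrite /sqnorm /dot !mulr_sumr -!big_split/=; apply: ler_sum => i _.
rewrite !mxE -subr_ge0.
rewrite (_ : _ - _ = t^-1 * (t * w 0 i - (v 0 i - w 0 i)) ^+ 2); last first.
  by field; rewrite gt_eqF.
by rewrite mulr_ge0 ?sqr_ge0// invr_ge0 ltW.
Qed.

Lemma measurable_dot (f g : borel_rV R n -> 'rV[R]_n) :
  (forall i, measurable_fun setT (fun x => f x 0 i)) ->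
  (forall i, measurable_fun setT (fun x => g x 0 i)) ->
  measurable_fun setT (fun x => dot (f x) (g x)).
Proof.
by move=> mf mg; apply: measurable_sum => i; exact: measurable_funM.
Qed.

End euclidean.

Section log_sobolev_dual.
Context {R : realType} {n : nat}.
Variable mu : probability (borel_rV R n) R.
Implicit Types (f : borel_rV R n -> R) (gf : borel_rV R n -> 'rV[R]_n).
Local Notation L1 f := (mu.-integrable setT (EFin \o f)).

(** An infimum need not come with its own inequality: a constant slightly above it is used, and
    finiteness of the energy keeps the excess below any given [d]. *)
Lemma C_LSI_le1 f : (C_LSI mu <= 1)%E -> smooth f -> (sq_mass mu f < +oo)%E ->
  (energy mu (grad f) < +oo)%E ->
  (Ent mu (fun x => f x ^+ 2)%R <= 2%:E * energy mu (grad f))%E.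
Proof.
move=> C1 sf f2 ef.
have e0 : (0 <= energy mu (grad f))%E.
  by apply: integral_ge0 => x _; rewrite lee_fin sqnorm_ge0.
have fin_e : energy mu (grad f) \is a fin_num by rewrite ge0_fin_numE.
apply/lee_addgt0Pr => d d0.
move: e0; rewrite -(fineK fin_e) lee_fin; set e := fine _ => e0.
(* The excess becomes [d e / (e + 1)]; the [+ 1] guards against zero energy. *)
have eta0 : 0 < d / (2 * (e + 1)) by rewrite divr_gt0//; lra.
have : (C_LSI mu < (1 + d / (2 * (e + 1)))%:E)%E.
  by apply: (le_lt_trans C1); rewrite lte_fin; lra.
move=> /ereal_inf_lt[_ [C [_ LC] <-]]; rewrite lte_fin => C1d.
apply: (le_trans (LC f sf f2)); rewrite -(fineK fin_e) -/e -EFinM -EFinD lee_fin.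
have : 2 * C * e <= 2 * (1 + d / (2 * (e + 1))) * e by nra.
suff : d / (2 * (e + 1)) * (2 * e) <= d by nra.
rewrite mulrAC ler_pdivrMr; nra.
Qed.

(* Unlike the entropy, the left-hand side is a continuous quadratic form of [f]
   in L^2. *)
Definition dual_LSI f gf := forall (phi : borel_rV R n -> R) B,
  measurable_fun setT phi -> (forall x, `|phi x| <= B) ->
  \int[mu]_x expR (phi x) <= 1 ->
  \int[mu]_x (f x ^+ 2 * phi x) <= 2 * \int[mu]_x sqnorm (gf x).

Lemma dual_LSI_smooth f : (C_LSI mu <= 1)%E -> smooth f ->
  L1 (fun x => f x ^+ 2) -> L1 (fun x => sqnorm (grad f x)) ->
  dual_LSI f (grad f).
Proof.
move=> C1 sf If Ie phi B mphi phiB ephi.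
have := entropy_dual (fun x => sqr_ge0 (f x)) If mphi phiB ephi.
move=> /le_trans/(_ (C_LSI_le1 C1 sf (integrable_lty measurableT If)
  (integrable_lty measurableT Ie))).
by rewrite /energy (integral_L1 Ie) -EFinM lee_fin.
Qed.

Lemma L1_sq_mass f : measurable_fun setT f -> (sq_mass mu f < +oo)%E ->
  L1 (fun x => f x ^+ 2).
Proof.
move=> mf f2; apply: L1_ge0 => // [|x]; last exact: sqr_ge0.
exact: measurable_funX.
Qed.

Lemma L1_energy gf : (forall i, measurable_fun setT (fun x => gf x 0 i)) ->
  (energy mu gf < +oo)%E -> L1 (fun x => sqnorm (gf x)).
Proof.
move=> mg g2; apply: L1_ge0 => // [|x]; last exact: sqnorm_ge0.
exact: measurable_dot.
Qed.

(** The error of replacing [f] by a smooth approximant is split by Young's inequality with weight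
    [t]. The factor [1 + t^-1] explodes as [t] decreases, hence the order of limits: first [r], the
    size of the approximation error, then [t]. *)
Lemma dual_LSI_H1 f gf : (C_LSI mu <= 1)%E -> H1_grad mu f gf -> dual_LSI f gf.
Proof.
move=> C1 [mf mgf f2 gf2 [f_ sf_ [cf cg]]] phi B mphi phiB ephi.
have B0 : 0 <= B by exact: le_trans (normr_ge0 _) (phiB 0).
have If := L1_sq_mass mf f2; have Ig := L1_energy mgf gf2.
set a := \int[mu]_x _; set e := \int[mu]_x _.
pose m := \int[mu]_x (f x ^+ 2).
have e0 : 0 <= e by apply: Rintegral_ge0 => x _; exact: sqnorm_ge0.
have key t : 0 < t < 1 -> forall r, 0 < r ->
    a <= 2 * (1 + t) * e + B * t * m + (2 + B) * (1 + t^-1) * r.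
  move=> /andP[t0 t1] r r0.
  have tV0 : 0 < t^-1 by rewrite invr_gt0.
  have near_r (u : nat -> \bar R) : u k @[k --> \oo] --> 0%E ->
      \forall k \near \oo, (u k < r%:E)%E.
    move=> cu; apply: (cu (fun y => (y < r%:E)%E)).
    by apply: open_ereal_lt'; rewrite lte_fin.
  have [k [fk gk]] : exists k, (sq_mass mu (fun x => f_ k x - f x)%R < r%:E)%E /\
      (energy mu (fun x => grad (f_ k) x - gf x)%R < r%:E)%E.
    have [N _ HN] := filterI (near_r _ cf) (near_r _ cg).
    by exists N; exact: (HN N (leqnn N)).
  have mfk := smooth_measurable (sf_ k).
  have mgk i := smooth_grad_measurable i (sf_ k).
  have Id : L1 (fun x => (f_ k x - f x) ^+ 2).
    apply: L1_sq_mass (lt_trans fk (ltry _)); exact: measurable_funB.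
  have Igd : L1 (fun x => sqnorm (grad (f_ k) x - gf x)).
    apply: L1_energy (lt_trans gk (ltry _)) => i.
    rewrite (_ : (fun x => _) = (fun x => grad (f_ k) x 0 i - gf x 0 i)).
      exact: measurable_funB.
    by apply/funext => x; rewrite !mxE.
  have mk := measurable_funX 2 mfk.
  (* [H1_grad] bounds only the differences; the approximant is square integrable because [f] and the
     difference are. *)
  have Ifk : L1 (fun x => f_ k x ^+ 2).
    apply: (L1_le mk (L1D (L1Z 2 If) (L1Z 2 Id))) => x.
    rewrite ger0_norm ?sqr_ge0// -subr_ge0.
    by have := sqr_ge0 (f x - (f_ k x - f x)); nra.
  have Igk : L1 (fun x => sqnorm (grad (f_ k) x)).
    apply: (L1_le _ (L1D (L1Z (1 + t) Ig) (L1Z (1 + t^-1) Igd))) => [|x].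
      exact: measurable_dot.
    by rewrite ger0_norm ?sqnorm_ge0// sqnorm_le_perturb.
  have := dual_LSI_smooth C1 (sf_ k) Ifk Igk mphi phiB ephi.
  have rd : \int[mu]_x ((f_ k x - f x) ^+ 2) <= r.
    by rewrite -lee_fin -integral_L1// ltW.
  have rg : \int[mu]_x (sqnorm (grad (f_ k) x - gf x)) <= r.
    by rewrite -lee_fin -integral_L1// ltW.
  have le_g : \int[mu]_x sqnorm (grad (f_ k) x) <= (1 + t) * e + (1 + t^-1) * r.
    apply: (@le_trans _ _ (\int[mu]_x ((1 + t) * sqnorm (gf x) +
        (1 + t^-1) * sqnorm (grad (f_ k) x - gf x)))).
      apply: Rint_le => //; first by apply: L1D; exact: L1Z.
      by move=> x; exact: sqnorm_le_perturb.
    rewrite Rint_D ?Rint_Z//; [|exact: L1Z..].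
    by rewrite lerD2l ler_pM2l//; lra.
  have Ifp : L1 (fun x => f x ^+ 2 * phi x) by exact: L1_Mbounded phiB.
  have Ifkp : L1 (fun x => f_ k x ^+ 2 * phi x) by exact: L1_Mbounded phiB.
  have le_a : a <= \int[mu]_x (f_ k x ^+ 2 * phi x) +
      (B * t * m + B * (1 + t^-1) * r).
    apply: (@le_trans _ _ (\int[mu]_x (f_ k x ^+ 2 * phi x +
        (B * t * f x ^+ 2 + B * (1 + t^-1) * (f_ k x - f x) ^+ 2)))).
      apply: Rint_le => //.
        by apply: L1D => //; apply: L1D; exact: L1Z.
      move=> x; rewrite -lerBlDl -mulrBl.
      (* With [d = f_ k x - f x] the left-hand side is [|2 f d + d^2|], and
         [2 |f d| <= t f^2 + t^-1 d^2]. *)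
      have dab : `|f x ^+ 2 - f_ k x ^+ 2| <=
          t * f x ^+ 2 + (1 + t^-1) * (f_ k x - f x) ^+ 2.
        set p := f x; set q := f_ k x.
        have tt : t * t^-1 = 1 by rewrite divff// gt_eqF.
        have H1 := sqr_ge0 (t * p - (q - p)).
        have H2 := sqr_ge0 (t * p + (q - p)).
        have H3 : 0 <= t^-1 * (t * p - (q - p)) ^+ 2 by rewrite mulr_ge0// ltW.
        have H4 : 0 <= t^-1 * (t * p + (q - p)) ^+ 2 by rewrite mulr_ge0// ltW.
        have E3 : t^-1 * (t * p - (q - p)) ^+ 2 =
            t * p ^+ 2 - 2 * p * (q - p) + t^-1 * (q - p) ^+ 2.
          by field; rewrite gt_eqF.
        have E4 : t^-1 * (t * p + (q - p)) ^+ 2 =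
            t * p ^+ 2 + 2 * p * (q - p) + t^-1 * (q - p) ^+ 2.
          by field; rewrite gt_eqF.
        have := sqr_ge0 (q - p); rewrite ler_norml; nra.
      apply: le_trans (ler_norm _) _; rewrite normrM.
      apply: (@le_trans _ _ (`|f x ^+ 2 - f_ k x ^+ 2| * B)).
        by rewrite ler_wpM2l.
      have := ler_wpM2r B0 dab; nra.
    rewrite Rint_D//; last by apply: L1D; exact: L1Z.
    rewrite Rint_D ?Rint_Z//; [|exact: L1Z..].
    rewrite !lerD2l; apply: ler_wpM2l => //.
    by rewrite mulr_ge0//; lra.
  nra.
have m0 : 0 <= m by apply: Rintegral_ge0 => x _; exact: sqr_ge0.
apply: (@small_parameter _ _ _ (2 * e + B * m)) => t t01.
apply: (@small_parameter _ _ _ ((2 + B) * (1 + t^-1))) => r /andP[r0 _].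
have := key t t01 r r0; nra.
Qed.

(** Adding [s * g] to every approximant leaves the differences to the limit unchanged. The
    discriminant argument takes place on the line [u + s h]. *)
Lemma H1_gradDZ f gf g (s : R) : H1_grad mu f gf -> smooth g ->
  (sq_mass mu g < +oo)%E -> (energy mu (grad g) < +oo)%E ->
  H1_grad mu (fun x => f x + s * g x) (fun x => gf x + s *: grad g x).
Proof.
move=> [mf mgf f2 gf2 [f_ sf_ [cf cg]]] sg g2 gg2.
have mg := smooth_measurable sg.
have mgg i := smooth_grad_measurable i sg.
have If := L1_sq_mass mf f2; have Ig := L1_energy mgf gf2.
have Ifg := L1_sq_mass mg g2; have Igg := L1_energy mgg gg2.
have mfg : measurable_fun setT (fun x => f x + s * g x).
  by apply: measurable_funD => //; exact: measurable_funM.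
have mgfg i : measurable_fun setT (fun x => (gf x + s *: grad g x) 0 i).
  rewrite (_ : (fun x => _) = (fun x => gf x 0 i + s * grad g x 0 i)).
    by apply: measurable_funD => //; exact: measurable_funM.
  by apply/funext => x; rewrite !mxE.
split => //.
- apply: (integrable_lty measurableT).
  apply: (L1_le (measurable_funX 2 mfg) (L1D (L1Z 2 If) (L1Z (2 * s ^+ 2) Ifg))) => x.
  by rewrite ger0_norm ?sqr_ge0//; have := sqr_ge0 (f x - s * g x); nra.
- apply: (integrable_lty measurableT).
  apply: (L1_le _ (L1D (L1Z 2 Ig) (L1Z (2 * s ^+ 2) Igg))) => [|x].
    exact: measurable_dot.
  rewrite ger0_norm ?sqnorm_ge0//; have := sqnorm_ge0 (gf x + (- s) *: grad g x).
  by rewrite !sqnormDZ; nra.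
- exists (fun k x => f_ k x + s * g x); first by move=> k; exact: smoothDZ.
  split.
    rewrite (_ : (fun k => sq_mass _ _) =
        (fun k => sq_mass mu (fun x => f_ k x - f x))) //.
    by apply/funext => k; congr sq_mass; apply/funext => x; ring.
  rewrite (_ : (fun k => energy _ _) =
      (fun k => energy mu (fun x => grad (f_ k) x - gf x))) //.
  apply/funext => k; congr energy; apply/funext => x.
  by rewrite gradDZ//; apply/rowP => i; rewrite !mxE; ring.
Qed.

End log_sobolev_dual.

(** * Square integrability of smooth functions of finite energy *)

Section smooth_finite_energy.
Context {R : realType} {n : nat}.
Variable mu : probability (borel_rV R n) R.
Local Notation L1 f := (mu.-integrable setT (EFin \o f)).

Lemma measurable_tail (h : borel_rV R n -> R) (a : R) :
  measurable_fun setT h -> measurable [set x | a < `|h x|].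
Proof.
move=> mh; rewrite -[X in measurable X]setTI.
apply: (@measurable_lte _ _ _ setT measurableT (EFin \o cst a)
  (EFin \o (fun x => `|h x|))).
  exact/measurable_EFinP.
by apply/measurable_EFinP; exact: (@measurableT_comp _ _ _ _ _ _ (@Num.norm _ R) _ h).
Qed.

(** As [h] is real-valued, its tails decrease to the empty set, and a finite measure is continuous
    from above. *)
Lemma tail_measure_small (h : borel_rV R n -> R) (e : R) :
  measurable_fun setT h -> 0 < e ->
  exists k : nat, (mu [set x | (k%:R < `|h x|)%R] < e%:E)%E.
Proof.
move=> mh e0.
pose F (k : nat) := [set x | k%:R < `|h x|].
have mF k : measurable (F k) by exact: measurable_tail.
have F0 : \bigcap_k F k = set0.
  apply/seteqP; split => // x Fx.
  have := Fx (Num.truncn `|h x|).+1 I; rewrite /F /=.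
  by rewrite ltNge ltW// truncnS_gt.
have cF : mu (F k) @[k --> \oo] --> mu (\bigcap_k F k).
  apply: nonincreasing_cvg_mu.
  - by rewrite ltey_eq fin_num_measure.
  - exact: mF.
  - by apply: bigcap_measurable => //; exists 0%N.
  - move=> i j ij; apply/subsetPset => x; rewrite /F /=; apply: le_lt_trans.
    by rewrite ler_nat.
rewrite F0 measure0 in cF.
have [N _ HN] : \forall k \near \oo, (mu (F k) < e%:E)%E.
  by apply: (cF (fun y => (y < e%:E)%E)); apply: open_ereal_lt'; rewrite lte_fin.
by exists N; exact: (HN N (leqnn N)).
Qed.

Lemma ratio_trunc_cvg (y : R) :
  (y * (1 + k.+1%:R^-1 * (y * y))^-1) ^+ 2 @[k --> \oo] --> y ^+ 2.
Proof.
have c0 : k.+1%:R^-1 @[k --> \oo] --> (0 : R) by exact: cvg_harmonic.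
have c1 : 1 + k.+1%:R^-1 * (y * y) @[k --> \oo] --> 1 + 0 * (y * y).
  by apply: cvgD; [exact: cvg_cst|apply: cvgM => //; exact: cvg_cst].
have c2 : y * (1 + k.+1%:R^-1 * (y * y))^-1 @[k --> \oo] --> y * (1 + 0 * (y * y))^-1.
  apply: cvgM; [exact: cvg_cst|apply: cvgV => //].
  by rewrite mul0r addr0 oner_neq0.
move: c2; rewrite mul0r addr0 invr1 mulr1 => c2.
by rewrite expr2; under eq_fun do rewrite expr2; exact: cvgM.
Qed.

(* Tested on truncations of [h], the dual inequality with [phi] equal to [1] on a
   tail [k < |h|] of small measure and to [-1] elsewhere bounds the L^2 norm. *)
Lemma smooth_energy_L2 (h : 'rV[R]_n -> R) : (C_LSI mu <= 1)%E -> smooth h ->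
  (energy mu (grad h) < +oo)%E -> (sq_mass mu h < +oo)%E.
Proof.
move=> C1 sh eh.
have mh := smooth_measurable sh.
have Ie := L1_energy (fun i => smooth_grad_measurable i sh) eh.
(* With a tail of measure at most [(2 * expR 1)^-1], the integral of [exp phi] is at most
   [exp (-1) + 1/2 <= 1]. *)
have e1 : 0 < (2 * expR 1 : R)^-1 by rewrite invr_gt0 mulr_gt0// expR_gt0.
have [k muk] := tail_measure_small mh e1.
pose F := [set x : borel_rV R n | k%:R < `|h x|].
have mF : measurable F by exact: measurable_tail.
have mI : measurable_fun setT (\1_F : borel_rV R n -> R) by exact: measurable_indic.
pose phi : borel_rV R n -> R := fun x => 2 * \1_F x - 1.
have phiE x : phi x = if x \in F then 1 else -1.
  by rewrite /phi indicE; case: (x \in F) => /=; lra.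
have mphi : measurable_fun setT phi.
  by apply: measurable_funB => //; exact: measurable_funM.
have phi1 x : `|phi x| <= 1 by rewrite phiE; case: ifP; rewrite ?normrN normr1.
have I1 : L1 (\1_F : borel_rV R n -> R).
  apply: (@L1_bounded _ _ _ _ _ 1) => // x.
  by rewrite indicE; case: (_ \in _); rewrite ?normr1 ?normr0.
have ephi : \int[mu]_x expR (phi x) <= 1.
  have E x : expR (phi x) = expR (-1) + (expR 1 - expR (-1)) * \1_F x.
    by rewrite phiE indicE; case: (x \in F) => /=; lra.
  under eq_Rintegral do rewrite E.
  rewrite Rint_D ?Rint_Z ?Rint_cst//; [|exact: L1_cst|exact: L1Z].
  have pF : \int[mu]_x \1_F x <= (2 * expR 1)^-1.
    by rewrite /Rintegral integral_indic// setIT -lee_fin fineK ?ltW//;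
      exact: fin_num_measure.
  have p0 : 0 <= \int[mu]_x \1_F x by apply: Rintegral_ge0 => x _; rewrite indicE.
  have e2 : 2 <= expR 1 :> R by have := expR_ge1Dx (1 : R).
  have : expR (-1) <= 2^-1 :> R by rewrite expRN lef_pV2// posrE// expR_gt0.
  have : expR 1 * (2 * expR 1)^-1 = 2^-1 :> R by field; rewrite gt_eqF// expR_gt0.
  have := expR_gt0 (-1 : R); move: pF; set q := _^-1; nra.
have bound e : 0 < e -> (\int[mu]_x ((ratio_trunc e h x) ^+ 2)%:E <=
    (2 * \int[mu]_x sqnorm (grad h x) + 2 * k%:R ^+ 2)%R%:E)%E.
  move=> e0; have sf := ratio_trunc_smooth (ltW e0) sh.
  have mf := measurable_funX 2 (smooth_measurable sf).
  have den x := ratio_trunc_den_gt0 (h x) (ltW e0).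
  have If : L1 (fun x => ratio_trunc e h x ^+ 2).
    apply: (@L1_bounded _ _ _ _ _ e^-1) => // x.
    rewrite ger0_norm ?sqr_ge0// /ratio_trunc -[leRHS]mul1r ler_pdivlMr//.
    rewrite exprMn exprVn mulrAC ler_pdivrMr ?exprn_gt0// mul1r.
    have := sqr_ge0 (h x); set y := h x; nra.
  have le_grad x : sqnorm (grad (ratio_trunc e h) x) <= sqnorm (grad h x).
    rewrite (grad_ratio_trunc _ (ltW e0))// sqnormZ ler_piMl ?sqnorm_ge0//.
    rewrite expr_div_n ler_pdivrMr ?exprn_gt0// mul1r.
    have : 0 <= e * (h x * h x) by rewrite mulr_ge0 ?(ltW e0)// -expr2 sqr_ge0.
    set z := e * _; clear; nra.
  have Ig : L1 (fun x => sqnorm (grad (ratio_trunc e h) x)).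
    apply: (L1_le _ Ie) => [|x]; last by rewrite ger0_norm ?sqnorm_ge0.
    by apply: measurable_dot => i; exact: smooth_grad_measurable.
  have dual := dual_LSI_smooth C1 sf If Ig mphi phi1 ephi.
  have le_e := Rint_le Ig Ie le_grad.
  rewrite integral_L1// lee_fin.
  have Ifp : L1 (fun x => ratio_trunc e h x ^+ 2 * phi x) by exact: L1_Mbounded phi1.
  (* Where [phi = -1], [|h| <= k] bounds the squared truncation by [k^2], so adding [2 k^2] makes up
     for the sign; the resulting bound is free of [e]. *)
  apply: (@le_trans _ _
      (\int[mu]_x (ratio_trunc e h x ^+ 2 * phi x) + 2 * k%:R ^+ 2)); last first.
    by rewrite lerD2r; apply: le_trans dual _; rewrite ler_pM2l.
  rewrite -[X in _ + X](Rint_cst mu) -Rint_D//; last exact: L1_cst.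
  apply: Rint_le => //; first by apply: L1D => //; exact: L1_cst.
  move=> x; rewrite phiE; case: ifPn => [_|].
    by rewrite mulr1 lerDl mulr_ge0// sqr_ge0.
  rewrite notin_setE /F /= => /negP; rewrite -leNgt => hk.
  have : ratio_trunc e h x ^+ 2 <= h x ^+ 2.
    rewrite /ratio_trunc exprMn ler_piMr ?sqr_ge0//.
    rewrite exprVn invf_le1 ?exprn_gt0// exprn_ege1// lerDl.
    by rewrite mulr_ge0 ?(ltW e0)// -expr2 sqr_ge0.
  have : h x ^+ 2 <= k%:R ^+ 2.
    by rewrite -(real_normK (num_real (h x))) ler_sqr ?nnegrE.
  move: (ratio_trunc e h x ^+ 2) (h x ^+ 2) (k%:R ^+ 2 : R) => p q r.
  by clear; lra.
have pos (j : nat) : 0 < j.+1%:R^-1 :> R by rewrite invr_gt0 ltr0n.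
have [||||//|I2 _] := @fatou_bound _ _ _ mu
    (fun j x => ratio_trunc j.+1%:R^-1 h x ^+ 2) (fun x => h x ^+ 2)
    (2 * \int[mu]_x sqnorm (grad h x) + 2 * k%:R ^+ 2).
- move=> j; apply: measurable_funX; apply: smooth_measurable.
  exact: ratio_trunc_smooth (ltW (pos j)) sh.
- by move=> j x; exact: sqr_ge0.
- exact: measurable_funX.
- by move=> x; exact: ratio_trunc_cvg.
- by move=> j; exact: bound.
exact: integrable_lty I2.
Qed.

End smooth_finite_energy.

(** * The dual inequality for test functions bounded below *)

Section unbounded_dual.
Context {R : realType} {n : nat}.
Variable mu : probability (borel_rV R n) R.
Implicit Types (f phi : borel_rV R n -> R) (gf : borel_rV R n -> 'rV[R]_n).
Local Notation L1 f := (mu.-integrable setT (EFin \o f)).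

(** Capping [phi] at [k] only lowers the exponential integral, so the bounded inequality applies to
    each cap. The lower bound on [phi] makes [f^2 (ph k + c')] nonnegative, as Fatou's lemma
    requires. *)
Lemma dual_LSI_unbounded f gf phi c : dual_LSI mu f gf ->
  L1 (fun x => f x ^+ 2) -> measurable_fun setT phi ->
  (forall x, - c <= phi x) -> L1 (fun x => expR (phi x)) ->
  \int[mu]_x expR (phi x) <= 1 ->
  L1 (fun x => f x ^+ 2 * phi x) /\
  \int[mu]_x (f x ^+ 2 * phi x) <= 2 * \int[mu]_x sqnorm (gf x).
Proof.
move=> dual If mphi phic Ie ephi.
have mf2 := L1_measurable If.
pose ph (k : nat) : borel_rV R n -> R := fun x => Num.min (phi x) k%:R.
have mph k : measurable_fun setT (ph k) by exact: measurable_minr.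
(* The cap at [0] may fall below a positive [- c]; [- |c|] bounds every cap. *)
pose c' := `|c|.
have cc' : c <= c' := ler_norm c.
have c'0 : 0 <= c' := normr_ge0 c.
have phc k x : - c' <= ph k x.
  have k0 : 0 <= k%:R :> R := ler0n _ _.
  have phx := phic x.
  by rewrite le_min; apply/andP; split; lra.
have phk k x : `|ph k x| <= c' + k%:R.
  have k0 : 0 <= k%:R :> R := ler0n _ _.
  have := phc k x; have : ph k x <= k%:R by rewrite ge_min lexx orbT.
  by rewrite ler_norml => ? ?; apply/andP; split; lra.
have Ifk k : L1 (fun x => f x ^+ 2 * ph k x) by exact: L1_Mbounded (phk k).
have bk k : \int[mu]_x (f x ^+ 2 * ph k x) <= 2 * \int[mu]_x sqnorm (gf x).
  apply: (dual _ _ (mph k) (phk k)); apply: le_trans ephi; apply: Rint_le => //.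
    apply: (L1_le _ Ie) => [|x]; first exact: measurableT_comp.
    by rewrite ger0_norm ?expR_ge0// ler_expR ge_min lexx.
  by move=> x; rewrite ler_expR ge_min lexx.
have [||||k|I2 le2] := @fatou_bound _ _ _ mu
    (fun k x => f x ^+ 2 * ph k x + c' * f x ^+ 2)
    (fun x => f x ^+ 2 * phi x + c' * f x ^+ 2)
    (2 * (\int[mu]_x sqnorm (gf x)) + c' * \int[mu]_x (f x ^+ 2)).
- move=> k; apply: L1_measurable (L1D (Ifk k) (L1Z c' If)).
- by move=> k x; rewrite mulrC -mulrDl mulr_ge0 ?sqr_ge0// -lerBlDr sub0r.
- by apply: measurable_funD; apply: measurable_funM.
- move=> x; apply: cvg_near_cst; exists (Num.truncn `|phi x|).+1 => // k /= kx.
  rewrite /ph (_ : Num.min _ _ = phi x)//; apply/min_idPl.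
  apply: le_trans (ler_norm _) _; apply: ltW.
  by apply: lt_le_trans (truncnS_gt _) _; rewrite ler_nat.
- rewrite integral_L1 ?lee_fin; last by apply: L1D; [exact: Ifk|exact: L1Z].
  rewrite Rint_D; [|exact: Ifk|exact: L1Z].
  by rewrite Rint_Z// lerD2r.
have E : (fun x => f x ^+ 2 * phi x) =
    (fun x => f x ^+ 2 * phi x + c' * f x ^+ 2 - c' * f x ^+ 2).
  by apply/funext => x; rewrite addrK.
rewrite E; split; first by apply: L1B => //; exact: L1Z.
by rewrite Rint_B; [rewrite Rint_Z// lerBlDr|exact: I2|exact: L1Z].
Qed.

End unbounded_dual.

(** * The regularized quadratic form *)

Section regularized_form.
Context {R : realType} {n : nat} (mu : probability (borel_rV R n) R).
Context (u h : borel_rV R n -> R) (gu : borel_rV R n -> 'rV[R]_n).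
Local Notation L1 f := (mu.-integrable setT (EFin \o f)).
Hypothesis C1 : (C_LSI mu <= 1)%E.
Hypothesis uH1 : H1_grad mu u gu.
Hypothesis sh : smooth h.
Hypothesis eh : (energy mu (grad h) < +oo)%E.

Let alpha := \int[mu]_x (u x ^+ 2).
Let mass_h := \int[mu]_x (h x ^+ 2).
Let Eu := \int[mu]_x sqnorm (gu x).
Let Eh := \int[mu]_x sqnorm (grad h x).
Let D := \int[mu]_x dot (grad h x) (gu x).

Let m_u : measurable_fun setT u. Proof. by case: uH1. Qed.
Let mh : measurable_fun setT h. Proof. exact: smooth_measurable. Qed.
Let h2 : (sq_mass mu h < +oo)%E. Proof. exact: smooth_energy_L2. Qed.

Lemma L1_u_sqr : L1 (fun x => u x ^+ 2).
Proof. by case: uH1 => *; exact: L1_sq_mass. Qed.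

Lemma L1_h_sqr : L1 (fun x => h x ^+ 2).
Proof. exact: L1_sq_mass. Qed.

Lemma L1_gu : L1 (fun x => sqnorm (gu x)).
Proof. by case: uH1 => *; exact: L1_energy. Qed.

Lemma L1_gh : L1 (fun x => sqnorm (grad h x)).
Proof. by apply: L1_energy => // i; exact: smooth_grad_measurable. Qed.

Lemma L1_dot : L1 (fun x => dot (grad h x) (gu x)).
Proof.
apply: (L1_le _ (L1D L1_gh L1_gu)) => [|x]; last exact: dot_le.
by case: uH1 => *; apply: measurable_dot => // i; exact: smooth_grad_measurable.
Qed.

Lemma L1_hu : L1 (fun x => h x * u x).
Proof. by apply: L1_prod => //; [exact: L1_h_sqr|exact: L1_u_sqr]. Qed.

Lemma energy_sum s :
  \int[mu]_x sqnorm (gu x + s *: grad h x) = Eu + 2 * s * D + s ^+ 2 * Eh.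
Proof.
under eq_Rintegral do rewrite sqnormDZ.
have Iu := L1_gu; have Ih := L1_gh; have Id := L1_dot.
rewrite Rint_D; [|by apply: L1D => //; exact: L1Z|exact: L1Z].
by rewrite Rint_D ?Rint_Z//; exact: L1Z.
Qed.

Lemma alpha_ge0 : 0 <= alpha.
Proof. by apply: Rintegral_ge0 => x _; exact: sqr_ge0. Qed.

(** The zero-mass case rests on this unweighted inequality. *)
Lemma dot_integral_sqr_le : D ^+ 2 <= Eu * Eh.
Proof.
apply: discriminant_le; first by apply: Rintegral_ge0 => x _; exact: sqnorm_ge0.
move=> s; rewrite -energy_sum; apply: Rintegral_ge0 => x _; exact: sqnorm_ge0.
Qed.

Hypothesis alpha_gt0 : 0 < alpha.

(** Written as a difference so that the errors of the numerator and of the normalization are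
    estimated separately. *)
Definition reg_log (r : R) : borel_rV R n -> R :=
  fun x => ln (u x ^+ 2 + r ^+ 2) - ln (alpha + r ^+ 2).

Section fixed_r.
Context (r : R) (r0 : 0 < r).
Local Notation w := (reg_log r).

Let r2 : 0 < r ^+ 2. Proof. by rewrite exprn_gt0. Qed.
Let ur x : 0 < u x ^+ 2 + r ^+ 2. Proof. by rewrite ltr_wpDl ?sqr_ge0. Qed.
Let ar : 0 < alpha + r ^+ 2. Proof. by rewrite addr_gt0. Qed.

Lemma measurable_reg_log : measurable_fun setT w.
Proof.
apply: measurable_funB => //; apply: measurableT_comp => //.
by apply: measurable_funD => //; exact: measurable_funX.
Qed.

Lemma reg_log_ge x : ln (r ^+ 2) - ln (alpha + r ^+ 2) <= w x.
Proof. by rewrite lerD2r ler_ln ?posrE// lerDr sqr_ge0. Qed.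

Lemma expR_reg_log x : expR (w x) = (alpha + r ^+ 2)^-1 * (u x ^+ 2 + r ^+ 2).
Proof. by rewrite expRB !lnK ?posrE// mulrC. Qed.

Let Ie : L1 (fun x => expR (w x)).
Proof.
rewrite (_ : (fun x => _) = fun x => (alpha + r ^+ 2)^-1 * (u x ^+ 2 + r ^+ 2)).
  by apply: L1Z; apply: L1D; [exact: L1_u_sqr|exact: L1_cst].
by apply/funext => x; rewrite expR_reg_log.
Qed.

Let int_e : \int[mu]_x expR (w x) <= 1.
Proof.
under eq_Rintegral do rewrite expR_reg_log.
have Iu := L1_u_sqr; have Ic := L1_cst mu (r ^+ 2).
rewrite Rint_Z; last exact: L1D.
by rewrite Rint_D// Rint_cst mulVf// gt_eqF.
Qed.

Let unb f gf : dual_LSI mu f gf -> L1 (fun x => f x ^+ 2) ->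
  L1 (fun x => f x ^+ 2 * w x) /\
  \int[mu]_x (f x ^+ 2 * w x) <= 2 * \int[mu]_x sqnorm (gf x).
Proof.
move=> dual If; apply: (@dual_LSI_unbounded _ _ _ _ _ _
  (- (ln (r ^+ 2) - ln (alpha + r ^+ 2))) dual If measurable_reg_log) => //.
by move=> x; rewrite opprK; exact: reg_log_ge.
Qed.

Lemma reg_u : L1 (fun x => u x ^+ 2 * w x) /\ \int[mu]_x (u x ^+ 2 * w x) <= 2 * Eu.
Proof. by apply: unb; [exact: dual_LSI_H1|exact: L1_u_sqr]. Qed.

Lemma reg_h : L1 (fun x => h x ^+ 2 * w x) /\ \int[mu]_x (h x ^+ 2 * w x) <= 2 * Eh.
Proof.
by apply: unb; [apply: dual_LSI_H1 => //; exact: smooth_H1_grad|exact: L1_h_sqr].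
Qed.

(** [|h u| <= h^2 + u^2] may be multiplied by [|w|] whatever the sign of [w]. *)
Lemma reg_hu : L1 (fun x => h x * u x * w x).
Proof.
have [Iu _] := reg_u; have [Ih _] := reg_h; have mw := measurable_reg_log.
apply: (L1_le _ (L1D (L1_norm Ih) (L1_norm Iu))) => [|x].
  by do 2 apply: measurable_funM => //.
rewrite !normrM -mulrDl; apply: ler_wpM2r => //.
have := normr_ge0 (h x); have := normr_ge0 (u x).
by move: `|h x| `|u x| => a b; nra.
Qed.

(** Everything is doubled to avoid halves: the right-hand factors are twice the regularized form at
    [u] and at [h]. Its nonnegativity along [u + s h] is the dual inequality with the same test
    function for all [s], whence the discriminant. *)
Lemma reg_cauchy_schwarz :
  (2 * D - \int[mu]_x (h x * u x * w x)) ^+ 2 <=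
  (2 * Eu - \int[mu]_x (u x ^+ 2 * w x)) *
  (2 * Eh - \int[mu]_x (h x ^+ 2 * w x)).
Proof.
have [Iu leu] := reg_u; have [Ih leh] := reg_h; have Ihu := reg_hu.
apply: discriminant_le => [|s]; first by rewrite subr_ge0.
have Hs : H1_grad mu (fun x => u x + s * h x) (fun x => gu x + s *: grad h x).
  exact: H1_gradDZ.
have Is : L1 (fun x => (u x + s * h x) ^+ 2).
  by case: Hs => *; exact: L1_sq_mass.
have [_ les] := unb (dual_LSI_H1 C1 Hs) Is.
have E : \int[mu]_x ((u x + s * h x) ^+ 2 * w x) =
    \int[mu]_x (u x ^+ 2 * w x) + 2 * s * \int[mu]_x (h x * u x * w x) +
    s ^+ 2 * \int[mu]_x (h x ^+ 2 * w x).
  rewrite -!Rint_Z//.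
  rewrite -Rint_D//; last exact: L1Z.
  rewrite -Rint_D//; [|by apply: L1D => //; exact: L1Z|exact: L1Z].
  by apply: eq_Rintegral => x _; ring.
move: les; rewrite energy_sum E.
move: (\int[mu]_x (u x ^+ 2 * w x)) (\int[mu]_x (h x * u x * w x))
  (\int[mu]_x (h x ^+ 2 * w x)) Eu D Eh => a b c a' b' c'.
by nra.
Qed.

(** Replacing [ln (u^2)] by [ln (u^2 + r^2)] only lowers the form at [u]; the sole loss is the
    normalization, [alpha (ln (alpha + r^2) - ln alpha) <= r^2]. *)
Lemma reg_deficit_le eps :
  ((2 * (1 - eps))%:E * energy mu gu <= Ent mu (fun x => u x ^+ 2)%R)%E ->
  2 * Eu - \int[mu]_x (u x ^+ 2 * w x) <= 2 * (eps * Eu) + r ^+ 2.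
Proof.
have [Iu _] := reg_u; have Iuu := L1_u_sqr.
rewrite /energy (integral_L1 L1_gu) -/Eu /Ent.
rewrite -[fine _]/alpha => hyp.
have : ((2 * (1 - eps) * Eu)%:E <= (\int[mu]_x (u x ^+ 2 * w x) +
    ln (alpha + r ^+ 2) * alpha)%:E - (alpha * ln alpha)%:E)%E.
  rewrite EFinM; apply: (le_trans hyp); apply: leeB => //.
  rewrite -Rint_Z// -Rint_D//; last exact: L1Z.
  rewrite -integral_L1; last by apply: L1D => //; exact: L1Z.
  apply: le_integral_measurable.
  - apply/measurable_EFinP; apply: measurable_funM; first exact: measurable_funX.
    by apply: measurableT_comp => //; exact: measurable_funX.
  - exact: measurable_int (L1D Iu (L1Z _ Iuu)).
  - move=> x; rewrite lee_fin [X in _ + X]mulrC -mulrDr /reg_log subrK.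
    (* At a zero of [u] the default [ln 0 = 0] may exceed [ln (r^2)], but its factor vanishes. *)
    have [->|ux] := eqVneq (u x ^+ 2) 0; first by rewrite !mul0r.
    rewrite ler_wpM2l ?sqr_ge0// ler_ln ?posrE//; last by rewrite lt0r ux sqr_ge0.
    by rewrite lerDl ltW.
rewrite -EFinB lee_fin.
have la : alpha * ln (alpha + r ^+ 2) <= alpha * ln alpha + r ^+ 2.
  have := ler_wpM2l (ltW alpha_gt0) (ln_add_le alpha_gt0 r2).
  by rewrite mulrDr (mulrC alpha (_ / alpha)) divfK// gt_eqF.
move: la; move: (\int[mu]_x (u x ^+ 2 * w x)) => I.
by move: alpha (ln (alpha + _)) (ln alpha) Eu => ? ? ? ?; nra.
Qed.

(** The weight is at least [- 2 ln (1 / r) - ln (alpha + r^2)], and [ln (1 / r) <= 1 / r]; so crude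
    a bound suffices against a factor [r^2]. *)
Lemma reg_h_ge :
  - (2 / r + ln (alpha + r ^+ 2)) * mass_h <= \int[mu]_x (h x ^+ 2 * w x).
Proof.
have [Ih _] := reg_h; have Ihh := L1_h_sqr.
rewrite -Rint_Z//; apply: Rint_le => //; first exact: L1Z.
move=> x; rewrite mulrC ler_wpM2l ?sqr_ge0//.
apply: le_trans (reg_log_ge x); rewrite opprD lerD2r lnXn// mulr2n.
have := ln_sublinear (_ : 0 < r^-1); rewrite invr_gt0 => /(_ r0).
rewrite lnV ?posrE//; by move: (ln r) r^-1 => a b ?; lra.
Qed.

(** The factor [u] cancels the singularity of the logarithm at its zeros, leaving a numerator error
    [2 r |h|]; the normalization contributes [r^2 / alpha |h u|]. Both are integrable, so
    integrability passes from the regularized cross term to the limiting one. *)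
Lemma reg_hu_close : L1 (fun x => h x * u x * ln (u x ^+ 2 / alpha)) /\
  `|\int[mu]_x (h x * u x * ln (u x ^+ 2 / alpha)) -
    \int[mu]_x (h x * u x * w x)| <=
  2 * r * \int[mu]_x `|h x| + r ^+ 2 / alpha * \int[mu]_x `|h x * u x|.
Proof.
have Ihu := reg_hu; have Ip := L1_norm L1_hu.
have I1 : L1 (fun x => `|h x|).
  by apply: L1_norm; apply: L1_of_sqr => //; exact: L1_h_sqr.
pose df := fun x => h x * u x * ln (u x ^+ 2 / alpha) - h x * u x * w x.
have mhl : measurable_fun setT (fun x => h x * u x * ln (u x ^+ 2 / alpha)).
  apply: measurable_funM; first exact: measurable_funM.
  apply: measurableT_comp => //; apply: measurable_funM => //.
  exact: measurable_funX.
have Ib : L1 (fun x => 2 * r * `|h x| + r ^+ 2 / alpha * `|h x * u x|).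
  by apply: L1D; exact: L1Z.
have dfb x : `|df x| <= 2 * r * `|h x| + r ^+ 2 / alpha * `|h x * u x|.
  rewrite /df -mulrBr normrM.
  have [ux|ux] := eqVneq (u x) 0.
    rewrite ux mulr0 normr0 !mul0r mulr0 addr0.
    by rewrite !mulr_ge0// ltW.
  have ux2 : 0 < u x ^+ 2 by rewrite exprn_even_gt0.
  rewrite ln_div ?posrE// /reg_log.
  have la : `|ln (alpha + r ^+ 2) - ln alpha| <= r ^+ 2 / alpha.
    rewrite ger0_norm ?subr_ge0 ?ler_ln ?posrE// ?lerDl ?(ltW r2)//.
    by rewrite lerBlDl ln_add_le.
  have lu := normM_ln_add_sqr (u x) r0.
  rewrite (_ : _ - _ - _ = (ln (alpha + r ^+ 2) - ln alpha) -
    (ln (u x ^+ 2 + r ^+ 2) - ln (u x ^+ 2))); last by ring.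
  apply: le_trans (ler_wpM2l (normr_ge0 _) (ler_normB _ _)) _.
  rewrite mulrDr addrC lerD//; last by rewrite mulrC ler_wpM2r.
  by rewrite normrM -mulrA mulrC ler_wpM2r.
have Idf : L1 df.
  apply: (L1_le _ Ib dfb); apply: measurable_funB => //.
  exact: L1_measurable Ihu.
have Ihl : L1 (fun x => h x * u x * ln (u x ^+ 2 / alpha)).
  rewrite (_ : (fun x => _) = fun x => df x + h x * u x * w x); first exact: L1D.
  by apply/funext => x; rewrite subrK.
split => //; rewrite -Rint_B// -!Rint_Z// -Rint_D; [|exact: L1Z..].
apply: le_trans (le_normr_Rintegral measurableT Idf) _.
by apply: Rint_le => //; exact: L1_norm.
Qed.

Lemma measurable_logratio :
  measurable_fun setT (logratio u alpha : borel_rV R n -> \bar R).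
Proof.
have m2 : measurable_fun setT (fun x => u x ^+ 2 / alpha).
  by apply: measurable_funM => //; exact: measurable_funX.
apply: measurable_fun_ifT => //; first exact: measurable_fun_ler.
by apply/measurable_EFinP; exact: measurableT_comp.
Qed.

(** Removing [r^2] from the numerator lowers the logarithm, and the normalization costs at most
    [r^2 / alpha]. This direction suits the right-hand side of the claim and also rules out the
    value [+oo] for the logarithmic integral. *)
Lemma integral_logratio_le :
  (\int[mu]_x ((h x ^+ 2)%:E * logratio u alpha x) <=
   (\int[mu]_x (h x ^+ 2 * w x) + r ^+ 2 / alpha * mass_h)%:E)%E.
Proof.
have [Ih _] := reg_h; have Ihh := L1_h_sqr.
have Is : L1 (fun x => h x ^+ 2 * w x + r ^+ 2 / alpha * h x ^+ 2).
  by apply: L1D => //; exact: L1Z.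
rewrite -Rint_Z// -Rint_D//; last exact: L1Z.
rewrite -integral_L1//; apply: le_integral_measurable.
- apply: emeasurable_funM; last exact: measurable_logratio.
  by apply/measurable_EFinP; exact: measurable_funX.
- exact: measurable_int Is.
- move=> x; rewrite [X in _ + X]mulrC -mulrDr [leRHS]EFinM.
  apply: lee_wpmul2l; first by rewrite lee_fin sqr_ge0.
  rewrite /logratio /=; case: ifPn => [_|]; first by rewrite leNye.
  rewrite -ltNge => ua; have ux2 : 0 < u x ^+ 2.
    by rewrite -(pmulr_lgt0 _ (_ : 0 < alpha^-1)) ?invr_gt0.
  rewrite lee_fin ln_div ?posrE// /reg_log.
  have := ln_add_le alpha_gt0 r2.
  have : ln (u x ^+ 2) <= ln (u x ^+ 2 + r ^+ 2) by rewrite ler_ln ?posrE// lerDl ltW.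
  move: (ln (u x ^+ 2)) (ln (u x ^+ 2 + r ^+ 2)) (ln alpha)
    (ln (alpha + _)) (r ^+ 2 / alpha)
    => a b c d e ? ?; lra.
Qed.

End fixed_r.

Let J := \int[mu]_x (h x * u x * ln (u x ^+ 2 / alpha)).

Let mass_h_ge0 : 0 <= mass_h.
Proof. by apply: Rintegral_ge0 => x _; exact: sqr_ge0. Qed.

Let Eu_ge0 : 0 <= Eu.
Proof. by apply: Rintegral_ge0 => x _; exact: sqnorm_ge0. Qed.

Let Eh_ge0 : 0 <= Eh.
Proof. by apply: Rintegral_ge0 => x _; exact: sqnorm_ge0. Qed.

Context (eps : R).
Hypothesis eps_ge0 : 0 <= eps.
Hypothesis near_ext :
  ((2 * (1 - eps))%:E * energy mu gu <= Ent mu (fun x => u x ^+ 2)%R)%E.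

(** Absorbs the cross-term error and the deficit estimate once for both finite and infinite [Q h],
    leaving only a product to bound. *)
Lemma form_sqr_le_limit Z N :
  (forall r, 0 < r < 1 -> (2 * (eps * Eu) + r ^+ 2) *
    (2 * Eh - \int[mu]_x (h x ^+ 2 * reg_log r x)) <= Z + N * r) ->
  (2 * D - J) ^+ 2 <= Z.
Proof.
move=> H.
pose p := \int[mu]_x `|h x|; pose q := \int[mu]_x `|h x * u x|.
apply: (@square_le_limit _ _ _ (2 * p + alpha^-1 * q) N) => r r01.
have /andP[r0 r1] := r01.
exists (2 * D - \int[mu]_x (h x * u x * reg_log r x)).
  rewrite opprB addrC addrA subrK distrC.
  have [_ /le_trans->//] := reg_hu_close r0.
  rewrite -/p -/q.
  have q0 : 0 <= alpha^-1 * q.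
    by rewrite mulr_ge0 ?invr_ge0 ?(ltW alpha_gt0)//; apply: Rintegral_ge0.
  have -> : r ^+ 2 / alpha * q = alpha^-1 * q * r ^+ 2 by ring.
  rewrite [leRHS]mulrDl; apply: lerD; first by rewrite mulrAC.
  apply: ler_wpM2l => //.
  by rewrite expr2 ger_pMl// ltW.
apply: (le_trans (reg_cauchy_schwarz r0)); apply: le_trans (H r r01).
apply: ler_wpM2r; last exact: reg_deficit_le.
by rewrite subr_ge0; have [] := reg_h r0.
Qed.

Lemma form_sqr_le_fin g :
  (\int[mu]_x ((h x ^+ 2)%:E * logratio u alpha x))%E = g%:E ->
  0 <= 2 * Eh - g /\ (2 * D - J) ^+ 2 <= 2 * (eps * Eu) * (2 * Eh - g).
Proof.
move=> gE; pose L := alpha^-1 * mass_h.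
have L0 : 0 <= L by rewrite mulr_ge0// invr_ge0 ltW.
have le_g r : 0 < r ->
    2 * Eh - \int[mu]_x (h x ^+ 2 * reg_log r x) <= 2 * Eh - g + L * r ^+ 2.
  move=> r0; have := integral_logratio_le r0; rewrite gE lee_fin /L.
  have -> : r ^+ 2 / alpha * mass_h = alpha^-1 * mass_h * r ^+ 2 by ring.
  by move: (\int[mu]_x _) (_ * r ^+ 2) => a b ?; lra.
(* Nonnegativity of [Q h], inherited from the regularized forms as [r] tends to [0]; the final
   square root depends on it. *)
have Y0 : 0 <= 2 * Eh - g.
  apply: (@small_parameter _ _ _ L) => r /andP[r0 r1].
  have [_ leh] := reg_h r0.
  apply: (@le_trans _ _ (2 * Eh - g + L * r ^+ 2)).
    by apply: le_trans (le_g r r0); rewrite subr_ge0.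
  by rewrite lerD2l ler_wpM2l// expr2 ger_pMl// ltW.
split => //; set X := 2 * (eps * Eu); set Y := 2 * Eh - g.
have X0 : 0 <= X by rewrite !mulr_ge0.
(* The error coefficients of the product below, whose powers [r^2] and [r^4] are at most [r]. *)
apply: (@form_sqr_le_limit _ (X * L + Y + L)) => r /andP[r0 r1].
apply: (@le_trans _ _ ((X + r ^+ 2) * (Y + L * r ^+ 2))).
  by apply: ler_wpM2l (le_g r r0); rewrite addr_ge0// sqr_ge0.
have rr : r ^+ 2 <= r by rewrite expr2 ger_pMl// ltW.
have r40 : r ^+ 2 * r ^+ 2 <= r.
  by apply: (le_trans _ rr); rewrite ger_pMl ?exprn_gt0// (le_trans rr)// ltW.
have XL : 0 <= X * L by exact: mulr_ge0.
rewrite (_ : _ * _ = X * Y + (X * L * r ^+ 2 + Y * r ^+ 2 +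
  L * (r ^+ 2 * r ^+ 2))); last by ring.
rewrite lerD2l [leRHS]mulrDl (mulrDl (X * L)).
by apply: lerD; [apply: lerD|]; exact: ler_wpM2l.
Qed.

(* Although [Q(h) = +oo] is possible here, the regularized form at [h] is only
   [O(1/r)], whereas the deficit is [O(r^2)]. *)
Lemma form_sqr_le0 : eps * Eu = 0 -> (2 * D - J) ^+ 2 <= 0.
Proof.
move=> e0.
apply: (@form_sqr_le_limit _ (2 * Eh + 2 * mass_h + (alpha + 1) * mass_h))
  => r /andP[r0 r1].
rewrite e0 mulr0 !add0r.
have rr : r ^+ 2 <= r by rewrite expr2 ger_pMl// ltW.
have la : ln (alpha + r ^+ 2) <= alpha + 1.
  have ar : 0 < alpha + r ^+ 2 by rewrite addr_gt0// exprn_gt0.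
  by apply: le_trans (ltW (ln_sublinear ar)) _; rewrite lerD2l (le_trans rr)// ltW.
apply: (@le_trans _ _ (r ^+ 2 * (2 * Eh + (2 / r + (alpha + 1)) * mass_h))).
  rewrite ler_wpM2l ?sqr_ge0// lerD2l lerNl; apply: le_trans (reg_h_ge r0).
  by rewrite mulNr lerN2 ler_wpM2r// lerD2l.
rewrite [leLHS](_ : _ = 2 * Eh * r ^+ 2 + 2 * mass_h * r +
  (alpha + 1) * mass_h * r ^+ 2); last by field; rewrite gt_eqF.
rewrite [leRHS]mulrDl (mulrDl (2 * Eh)); apply: lerD.
  by rewrite lerD2r; apply: ler_wpM2l => //; exact: mulr_ge0.
by apply: ler_wpM2l => //; apply: mulr_ge0 => //; rewrite addr_ge0// ltW.
Qed.
End regularized_form.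

(** * The degenerate case of zero mass *)

Section zero_mass.
Context {R : realType} {n : nat} (mu : probability (borel_rV R n) R).
Local Open Scope ereal_scope.

(** Since [0^-1 = 0], the ratio is [0] everywhere, at zeros of [u] or not. *)
Lemma logratio0 (u : 'rV[R]_n -> R) x : logratio u 0 x = -oo.
Proof. by rewrite /logratio invr0 mulr0 le0_lneNy. Qed.

Lemma integral_logratio0_le0 (u h : 'rV[R]_n -> R) :
  \int[mu]_x (((h x) ^+ 2)%:E * logratio u 0 x) <= 0.
Proof.
under eq_integral do rewrite logratio0 -[-oo]/(- +oo) muleN.
rewrite integral_ge0N ?oppe_le0 ?integral_ge0// => x _;
  by rewrite mule_ge0 ?leey// lee_fin sqr_ge0.
Qed.

(** Zero mass gives [u = 0] only almost everywhere; on the remaining null set [F] may be infinite,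
    as the cross term with weight [-oo] can be. *)
Lemma integral_vanishing (u : borel_rV R n -> R) (F : borel_rV R n -> \bar R) :
  measurable_fun setT u -> measurable_fun setT F -> sq_mass mu u = 0 ->
  (forall x, u x = 0%R -> F x = 0) -> \int[mu]_x F x = 0.
Proof.
move=> m_u mF u0 Fu.
have mu2 : measurable_fun setT (fun x => (u x ^+ 2)%:E).
  by apply/measurable_EFinP; exact: measurable_funX.
have ae0 : ae_eq mu setT (fun x => (u x ^+ 2)%:E) (cst 0).
  apply/ae_eq_integral_abs => //; rewrite -[RHS]u0; apply: eq_integral => x _.
  by rewrite gee0_abs// lee_fin sqr_ge0.
rewrite (@ae_eq_integral _ _ _ mu setT (cst 0))//; first by rewrite integral0.
move: ae0; apply: filterS => x /(_ I) [/eqP]; rewrite sqrf_eq0 => /eqP ux _ /=.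
exact: Fu.
Qed.

End zero_mass.

Local Open Scope ereal_scope.

Theorem lemma3p1 (R : realType) (n : nat) (mu : probability (borel_rV R n) R)
  (mu_LSI : C_LSI mu <= 1)
  (u : 'rV[R]_n -> R) (gu : 'rV[R]_n -> 'rV[R]_n) (u_H1 : H1_grad mu u gu)
  (eps : R) (eps_ge0 : (0 <= eps)%R)
  (u_near_ext : (2 * (1 - eps))%:E * energy mu gu <=
                Ent mu (fun x => (u x) ^+ 2)%R)
  (h : 'rV[R]_n -> R) (h_smooth : smooth h)
  (h_energy : energy mu (grad h) < +oo) :
  let alpha := fine (sq_mass mu u) in
  \int[mu]_x (dot (grad h x) (gu x))%:E
    - 2^-1%:E * \int[mu]_x ((h x * u x)%:E * logratio u alpha x)
  <= (Num.sqrt eps)%:E * sqrte (energy mu gu) *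
     sqrte (energy mu (grad h)
            - 2^-1%:E * \int[mu]_x (((h x) ^+ 2)%:E * logratio u alpha x)).
Proof.
lazy zeta; set alpha := fine (sq_mass mu u).
have Iu := L1_u_sqr u_H1.
have m_u : measurable_fun setT (u : borel_rV R n -> R) by case: u_H1.
have m_h := smooth_measurable h_smooth.
have sqm : sq_mass mu u = alpha%:E by exact: integral_L1.
have Eu0 : (0 <= \int[mu]_x sqnorm (gu x))%R.
  by apply: Rintegral_ge0 => x _; exact: sqnorm_ge0.
have Eh0 : (0 <= \int[mu]_x sqnorm (grad h x))%R.
  by apply: Rintegral_ge0 => x _; exact: sqnorm_ge0.
have eu : energy mu gu = (\int[mu]_x sqnorm (gu x))%:E := integral_L1 (L1_gu u_H1).
have eh : energy mu (grad h) = (\int[mu]_x sqnorm (grad h x))%:E :=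
  integral_L1 (L1_gh h_smooth h_energy).
rewrite (integral_L1 (L1_dot u_H1 h_smooth h_energy)) eu eh.
have : (0 <= alpha)%R := alpha_ge0 mu u.
rewrite le_eqVlt => /predU1P[a0|a_gt0].
  (* The entropy is zero here, so near-extremality forces zero energy of [gu] or [eps >= 1]; the
     unweighted Cauchy-Schwarz inequality settles both. *)
  have dle := dot_integral_sqr_le u_H1 h_smooth h_energy.
  have u0 : sq_mass mu u = 0 by rewrite sqm -a0.
  rewrite -a0 (integral_vanishing m_u _ u0); first last.
  - by move=> x ->; rewrite mulr0 mul0e.
  - under eq_fun do rewrite logratio0.
    by apply: emeasurable_funM => //; apply/measurable_EFinP; exact: measurable_funM.
  rewrite mule0 sube0.
  have Ent0 : Ent mu (fun x => (u x) ^+ 2)%R = 0.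
    rewrite /Ent -[fine _]/alpha -a0 mul0r sube0.
    apply: (integral_vanishing m_u _ u0) => [|x ->]; last by rewrite expr0n mul0r.
    apply/measurable_EFinP; apply: measurable_funM; first exact: measurable_funX.
    by apply: measurableT_comp => //; exact: measurable_funX.
  move: dle u_near_ext; rewrite Ent0 eu -EFinM lee_fin.
  move: Eu0; rewrite le_eqVlt => /predU1P[<-|Eu0] dle ne.
    move: dle; rewrite mul0r le_eqVlt ltNge sqr_ge0 orbF sqrf_eq0 => /eqP ->.
    by rewrite sqrte0 mule0 mul0e.
  have eps1 : (1 <= eps)%R.
    by move: ne; rewrite pmulr_lle0// pmulr_rle0// subr_le0.
  apply: (@le_trans _ _ ((Num.sqrt 1)%:E * sqrte (\int[mu]_x sqnorm (gu x))%:E *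
      sqrte (\int[mu]_x sqnorm (grad h x))%:E)).
    rewrite /= -!EFinM lee_fin; apply: le_sqrt_prod => //; first exact: ltW.
    by rewrite mul1r.
  apply: lee_pmul.
  - by rewrite mule_ge0 ?sqrte_ge0// lee_fin sqrtr_ge0.
  - exact: sqrte_ge0.
  - by apply: lee_wpmul2r; [exact: sqrte_ge0|rewrite lee_fin ler_wsqrtr].
  (* The logarithmic term is nonpositive, so subtracting it only enlarges the last factor. *)
  - have Gle : 0 <= - (2^-1%:E * \int[mu]_x (((h x) ^+ 2)%:E * logratio u 0 x)).
      by rewrite oppe_ge0 mule_ge0_le0 ?integral_logratio0_le0// lee_fin invr_ge0.
    rewrite lee_sqrt; first by rewrite leeDl.
    by rewrite adde_ge0// lee_fin.
have Ehu : \int[mu]_x ((h x * u x)%:E * logratio u alpha x) =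
    (\int[mu]_x (h x * u x * ln (u x ^+ 2 / alpha)))%:E.
  have [Ihl _] := reg_hu_close mu_LSI u_H1 h_smooth h_energy a_gt0 ltr01.
  rewrite -integral_L1//; apply: eq_integral => x _.
  (* At a zero of [u], the extended product [0 * -oo] and the real one [0 * ln 0] are both [0]. *)
  have [ux|ux] := eqVneq (u x) 0%R; first by rewrite ux mulr0 mul0r mul0e.
  rewrite /logratio lne_EFin -?EFinM// divr_gt0//.
  by rewrite exprn_even_gt0.
rewrite Ehu -EFinM -EFinB.
have half : (forall D J : R, D - 2^-1 * J = 2^-1 * (2 * D - J))%R by move=> D J; field.
rewrite half.
set b := (2 * _ - _)%R.
(* The bound at [r = 1] is finite, which excludes [+oo]. *)
have := integral_logratio_le mu_LSI u_H1 h_smooth h_energy a_gt0 ltr01.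
case Gg : (\int[mu]_x ((h x ^+ 2)%:E * logratio u alpha x)) => [g||]; last 2 first.
- by rewrite leye_eq.
- move=> _; rewrite gt0_muleNy ?lte_fin ?invr_gt0// addey//=.
  (* The last factor is now infinite, so the right-hand side is [+oo] unless [eps] times the energy
     vanishes; in that case the left-hand side is [0]. *)
  have [e0|e0] := eqVneq (eps * \int[mu]_x sqnorm (gu x))%R 0%R.
    have := form_sqr_le0 mu_LSI u_H1 h_smooth h_energy a_gt0 u_near_ext e0.
    rewrite -/b le_eqVlt ltNge sqr_ge0 orbF sqrf_eq0 => /eqP ->.
    by rewrite mulr0 !mule_ge0// lee_fin.
  rewrite -EFinM gt0_muley ?leey// lte_fin -sqrtrM// sqrtr_gt0.
  by rewrite lt0r e0 mulr_ge0.
- move=> _.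
  have [Y0 bY] :=
    form_sqr_le_fin mu_LSI u_H1 h_smooth h_energy a_gt0 eps_ge0 u_near_ext Gg.
  rewrite -[2^-1%:E * g%:E]EFinM -EFinB /= -!EFinM lee_fin half.
  apply: le_sqrt_prod => //.
    by rewrite mulr_ge0.
  rewrite exprMn -/b.
  rewrite [leRHS](_ : _ = 2^-1 ^+ 2 * (2 * (eps * \int[mu]_x sqnorm (gu x)) *
    (2 * \int[mu]_x sqnorm (grad h x) - g)))%R; last by field.
  by rewrite ler_wpM2l ?sqr_ge0.
Qed.
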